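(* Let $f:\mathbb{F}_2^n\to\mathbb{F}_2$ be an $s$-plateaued Boolean function with $4$-valued spectra (of $f$), whose Cayley graph $G_f$ is connected, and let $A$ be the adjacency matrix of $G_f$. Let $r=wt(f)$ and $$(\sigma,\mu,\nu)=\left(2^{-n}r^3+2^{n+s-2}-2^{s-2}r,\ 2^{-n}r^3-2^{s-2}r,\ 2^{-n}r^3-2^{s-2}r\right).$$ Then $G_f$ is strongly $\ell$-walk-regular for any odd $\ell$, of parameters $(\sigma_\ell,\mu_\ell,\nu_\ell)$, where $\ell=2t+1$ and $$\sigma_\ell=\mu\,\frac{2^{(n+s-2)t}-r^{2t}}{2^{n+s-2}-r^2}+2^{(n+s-2)t},\qquad \mu_\ell=\nu_\ell=\mu\,\frac{2^{(n+s-2)t}-r^{2t}}{2^{n+s-2}-r^2}.$$ Further, the following identity holds for all $t\ge 1$: $$A^{2t+1}=2^{(n+s-2)t}A+\mu\,\frac{2^{(n+s-2)t}-r^{2t}}{2^{n+s-2}-r^2}\,J,$$ where $J$ is the $2^n\times 2^n$ all-ones matrix.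
   Context: Here $n$ is a positive integer and $s$ is an integer. A Boolean function in $n$ variables is a map $f:\mathbb{F}_2^n\to\mathbb{F}_2$. Its weight is $wt(f)=|\{\mathbf{x}\in\mathbb{F}_2^n : f(\mathbf{x})=1\}|$. With $\mathbf{u}\cdot\mathbf{x}=\sum_{i=1}^n u_ix_i$, the Fourier transform of $f$ is $\mathcal{W}_f(\mathbf{u})=\sum_{\mathbf{x}\in\mathbb{F}_2^n}f(\mathbf{x})(-1)^{\mathbf{u}\cdot\mathbf{x}}$ and its Walsh-Hadamard transform is $\mathcal{W}_{\hat f}(\mathbf{u})=\sum_{\mathbf{x}\in\mathbb{F}_2^n}(-1)^{f(\mathbf{x})}(-1)^{\mathbf{u}\cdot\mathbf{x}}$ (both integer-valued). The function $f$ is called $s$-plateaued if $|\mathcal{W}_{\hat f}(\mathbf{u})|\in\{0,2^{(n+s)/2}\}$ for all $\mathbf{u}\in\mathbb{F}_2^n$. ''$4$-valued spectra (of $f$)'' means that the Fourier transform $\mathcal{W}_f$ takes exactly four distinct values; the values of $\mathcal{W}_f$ are the eigenvalues of the adjacency matrix of $G_f$. The Cayley graph $G_f$ of $f$ has vertex set $\mathbb{F}_2^n$ and edge set $E_f=\{(\mathbf{w},\mathbf{u})\in\mathbb{F}_2^n\times\mathbb{F}_2^n : f(\mathbf{w}\oplus\mathbf{u})=1\}$, where $\oplus$ is addition in $\mathbb{F}_2^n$. Its adjacency matrix $A$ has entry $f(\mathbf{w}\oplus\mathbf{u})$ in the position indexed by $\mathbf{w},\mathbf{u}$, and $G_f$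 is regular of degree $wt(f)$. For $\ell>1$, a graph is strongly $\ell$-walk-regular with parameters $(\sigma_\ell,\mu_\ell,\nu_\ell)$ if there are $\sigma_\ell$, $\mu_\ell$, $\nu_\ell$ walks of length $\ell$ between every two adjacent, every two non-adjacent, and every two identical vertices, respectively.
   Formalization: Strong walk-regularity is stated only for f(0)=0: if f(0)=1 every vertex of G_f has a loop and the number of closed walks is σ_ℓ, not ν_ℓ (e.g. f=x1x2+x3+1, n=3, s=1), so the claim fails; the matrix identity is stated for all f. *)

(* Defs.v *)
From mathcomp Require Import all_boot all_order all_algebra.
From mathcomp Require Import reals exp.

Set Implicit Arguments.
Unset Strict Implicit.
Unset Printing Implicit Defensive.

Import Order.TTheory GRing.Theory Num.Theory.
Local Open Scope ring_scope.

Section BooleanFunctions.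
Variable n : nat.
Implicit Types (f : 'rV['F_2]_n -> 'F_2) (u x : 'rV['F_2]_n).

Definition wt f : nat := #|[set x | f x == 1]|.

Definition dot u x : 'F_2 := \sum_(i < n) u 0 i * x 0 i.

(* Elements of 'F_2 are coerced to their representative in {0, 1}. *)
Definition fourier f u : int :=
  \sum_(x : 'rV['F_2]_n) (f x : nat)%:Z * (-1) ^+ (dot u x : nat).

Definition walsh_hadamard f u : int :=
  \sum_(x : 'rV['F_2]_n) (-1) ^+ (f x : nat) * (-1) ^+ (dot u x : nat).

(* The exponent (n + s) / 2 is real: n + s is not assumed to be even. *)
Definition plateaued (R : realType) (s : int) f : Prop :=
  forall u, let W : R := `|(walsh_hadamard f u)%:~R| in
    W = 0 \/ W = 2 `^ ((n%:R + s%:~R) / 2).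

Definition four_valued_spectrum f : Prop :=
  size (undup (codom (fourier f))) = 4%N.

Definition cayley f : rel 'rV['F_2]_n := fun w u => f (w + u) == 1.

(* Rows and columns are indexed by the enumeration of the 2 ^ n vectors. *)
Definition cayley_adj (R : realType) f : 'M[R]_#|{: 'rV['F_2]_n}| :=
  \matrix_(i, j) (f (enum_val i + enum_val j) : nat)%:R.

End BooleanFunctions.

Section Graphs.
Variables (T : finType) (e : rel T).

Definition connected_graph : Prop := forall x y : T, connect e x y.

(* A walk x = x_0, x_1, ..., x_l = y is encoded by the tuple (x_1, ..., x_l). *)
Definition num_walks (l : nat) (x y : T) : nat :=
  #|[set p : l.-tuple T | path e x p && (last x p == y)]|.

(* For loopless graphs: a loop at x would put (x, x) under both the first and
   the last clause. *)
Definition strongly_walk_regular (R : realType) (l : nat) (sigma mu nu : R)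
    : Prop :=
  (1 < l)%N /\
  forall x y : T,
    [/\ e x y -> (num_walks l x y)%:R = sigma,
        x != y -> ~~ e x y -> (num_walks l x y)%:R = mu
      & x = y -> (num_walks l x y)%:R = nu].

End Graphs.

(* Main.v *)
Require Import Defs.
From mathcomp Require Import all_boot all_order all_algebra.
From mathcomp Require Import reals exp.
From mathcomp Require Import ring zify.

Set Implicit Arguments.
Unset Strict Implicit.
Unset Printing Implicit Defensive.

Import Order.TTheory GRing.Theory Num.Theory.
Local Open Scope ring_scope.

(** The adjacency matrix A of G_f is a convolution operator on the group F_2^n,
    so the characters x |-> (-1)^(u.x) diagonalize it, with eigenvalues the
    Fourier coefficients W_f(u); they diagonalize the all-ones matrix J as well,
    with eigenvalue 2^n at u = 0 and 0 elsewhere.  Hence an identity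
    A^k = a A + b J amounts to scalar identities between eigenvalues
    ([cayley_adj_exp]): W_f(u)^k = a W_f(u) for u != 0, and
    r^k = a r + 2^n b for the trivial character, where r = W_f(0) = wt(f).

    Since (-1)^f = 1 - 2f, a nontrivial Fourier coefficient is -1/2 times the
    Walsh-Hadamard one, so plateauedness says that W_f(u) is 0 or a square root
    of L = 2^(n+s-2) ([plateaued_fourier_sqr]).  For odd k = 2t+1 this gives
    W_f(u)^k = L^t W_f(u), that is a = L^t, and then
    b = 2^-n (r^(2t+1) - L^t r).  This is the constant of the theorem, because
    mu = 2^-n r (r^2 - L), provided that r^2 != L so that the quotient makes
    sense.  Having four distinct values excludes r^2 = L: otherwise the
    spectrum would lie in {0, r, -r} ([four_valued_degree_neq]).

    Finally the entries of A^k count walks ([adj_mx_exp]), and the three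
    parameters are read off the entries of L^t A + b J. *)

Lemma sum_enum_val (V : nmodType) (T : finType) (F : T -> V) :
  \sum_(i < #|{: T}|) F (enum_val i) = \sum_x F x.
Proof. by rewrite -big_enum_val; apply: eq_bigl. Qed.

(** * Vectors over the field with two elements *)

Lemma F2_cases (a : 'F_2) : a = 0 \/ a = 1.
Proof. by case: a => [[|[|k]] lt_k] //; [left | right]; apply: val_inj. Qed.

Lemma F2_natE (a : 'F_2) : (a : nat) = (a == 1).
Proof. by case: (F2_cases a) => ->. Qed.

Lemma card_F2_vectors n : #|{: 'rV['F_2]_n}| = (2 ^ n)%N.
Proof. by rewrite card_mx card_Fp // mul1n. Qed.

Lemma F2_vector_addrr n (x : 'rV['F_2]_n) : x + x = 0.
Proof.
by apply/rowP => i; rewrite !mxE; case: (F2_cases (x 0 i)) => ->; apply: val_inj.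
Qed.

Lemma F2_addKr n (x : 'rV['F_2]_n) : involutive (+%R x).
Proof. by move=> y; rewrite addrA F2_vector_addrr add0r. Qed.

Lemma F2_add_eq0 n (x y : 'rV['F_2]_n) : (x + y == 0) = (x == y).
Proof. by rewrite -{1}(F2_addKr x 0) addr0 (inj_eq (addrI x)) eq_sym. Qed.

Lemma signF2D (R : pzRingType) (a b : 'F_2) :
  (-1) ^+ ((a + b)%R : nat) = (-1) ^+ (a : nat) * (-1) ^+ (b : nat) :> R.
Proof.
by case: (F2_cases a) => ->; case: (F2_cases b) => ->;
  rewrite -exprD -[LHS]signr_odd -[RHS]signr_odd.
Qed.

(** * Characters and the Hadamard matrix *)

Section Characters.
Variable n : nat.
Implicit Types u v x y : 'rV['F_2]_n.

Lemma dotC u x : dot u x = dot x u.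
Proof. by apply: eq_bigr => i _; rewrite mulrC. Qed.

Lemma dotDl u v x : dot (u + v) x = dot u x + dot v x.
Proof. by rewrite -big_split; apply: eq_bigr => i _; rewrite mxE mulrDl. Qed.

Lemma dotDr u x y : dot u (x + y) = dot u x + dot u y.
Proof. by rewrite dotC dotDl !(dotC u). Qed.

Lemma dot0l x : dot 0 x = 0.
Proof. by rewrite /dot big1 // => i _; rewrite mxE mul0r. Qed.

Lemma dot_delta u i : dot u (delta_mx 0 i) = u 0 i.
Proof.
rewrite /dot (bigD1 i) //= mxE !eqxx mulr1 big1 ?addr0 // => j /negPf nji.
by rewrite mxE eqxx nji mulr0.
Qed.

(** Translating by a basis vector e_i with u_i = 1 flips the sign of every term,
    so the sum over a nontrivial character equals its own opposite. *)
Lemma sum_character (R : numDomainType) u :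
  \sum_x (-1) ^+ (dot u x : nat) = if u == 0 then 2 ^+ n else 0 :> R.
Proof.
case: eqP => [->|/eqP/rV0Pn[i ui_neq0]].
  under eq_bigr do rewrite dot0l expr0.
  by rewrite sumr_const card_F2_vectors -natrX.
have ui1 : u 0 i = 1 by case: (F2_cases (u 0 i)) ui_neq0 => -> //; rewrite eqxx.
set S := \sum_x _.
have : S = - S.
  rewrite {1}/S (reindex_inj (addrI (delta_mx 0 i))) /= -sumrN.
  apply: eq_bigr => x _.
  by rewrite dotDr dot_delta ui1 signF2D expr1 mulN1r.
by move/eqP; rewrite -subr_eq0 opprK -mulr2n mulrn_eq0 => /eqP.
Qed.

(** The character table of F_2^n: column j lists the values of the character
    attached to the j-th vector. *)
Definition hadamard_mx (R : pzRingType) : 'M[R]_#|{: 'rV['F_2]_n}| :=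
  \matrix_(i, j) (-1) ^+ (dot (enum_val i) (enum_val j) : nat).

(** Orthogonality of characters; it makes the matrix invertible. *)
Lemma hadamard_mx_sqr (R : numDomainType) :
  hadamard_mx R *m hadamard_mx R = (2 ^+ n)%:M.
Proof.
apply/matrixP => i j; rewrite !mxE.
under eq_bigr => k _ do rewrite !mxE (dotC (enum_val k)) -signF2D -dotDl.
rewrite (sum_enum_val (fun x =>
  (-1) ^+ (dot (enum_val i + enum_val j) x : nat))).
by rewrite sum_character F2_add_eq0 (inj_eq enum_val_inj); case: eqP.
Qed.

Lemma hadamard_mx_inj (R : numFieldType) :
  injective (mulmx^~ (hadamard_mx R) : 'M_#|{: 'rV['F_2]_n}| -> _).
Proof.
move=> A B /= /(congr1 (mulmx^~ (hadamard_mx R))) /=.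
rewrite -!mulmxA hadamard_mx_sqr !mul_mx_scalar.
by apply: scalerI; rewrite expf_neq0 // pnatr_eq0.
Qed.

End Characters.

(** * Diagonalization of the Cayley graph *)

Section Spectrum.
Variables (n : nat) (f : 'rV['F_2]_n -> 'F_2).
Implicit Types u x : 'rV['F_2]_n.

Lemma fourier0 : fourier f 0 = wt f.
Proof.
rewrite /fourier /wt -sum1_card [X in _ = Posz X]big_mkcond.
rewrite -[RHS]natz natr_sum; apply: eq_bigr => x _.
by rewrite dot0l expr0 mulr1 F2_natE inE; case: (f x == 1).
Qed.

Lemma walsh_hadamardE u :
  walsh_hadamard f u = (if u == 0 then 2 ^+ n else 0) - 2 * fourier f u.
Proof.
rewrite -sum_character mulr_sumr -sumrB; apply: eq_bigr => x _.
by rewrite F2_natE; case: (f x == 1); rewrite /= ?expr0 ?expr1; ring.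
Qed.

Definition fourier_row (R : pzRingType) : 'rV[R]_#|{: 'rV['F_2]_n}| :=
  \row_j (fourier f (enum_val j))%:~R.

(** Each character is an eigenvector of the Cayley graph: substituting x + y for
    y in sum_y f(x + y) (-1)^(u.y) pulls out the factor (-1)^(u.x). *)
Lemma cayley_adj_mul_hadamard (R : realType) :
  cayley_adj R f *m hadamard_mx n R =
  hadamard_mx n R *m diag_mx (fourier_row R).
Proof.
rewrite mul_mx_diag; apply/matrixP => i j; rewrite !mxE.
under eq_bigr => k _ do rewrite !mxE.
rewrite (sum_enum_val (fun x =>
  (f (enum_val i + x) : nat)%:R * (-1) ^+ (dot x (enum_val j) : nat))).
rewrite (reindex_inj (addrI (enum_val i))) /= rmorph_sum mulr_sumr.
apply: eq_bigr => x _.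
rewrite F2_addKr dotDl signF2D (dotC x) rmorphM rmorphXn /= rmorphN1.
by rewrite mulrCA.
Qed.

Lemma const_mx_mul_hadamard (R : realType) :
  const_mx 1 *m hadamard_mx n R =
  hadamard_mx n R *m
    diag_mx (\row_j (if enum_val j == 0 then 2 ^+ n else 0)).
Proof.
rewrite mul_mx_diag; apply/matrixP => i j; rewrite !mxE.
under eq_bigr => k _ do rewrite !mxE mul1r dotC.
rewrite (sum_enum_val (fun x => (-1) ^+ (dot (enum_val j) x : nat))).
rewrite sum_character; case: eqP => [->|_]; last by rewrite mulr0.
by rewrite dotC dot0l mul1r.
Qed.

Lemma cayley_adj_exp_mul_hadamard (R : realType) k :
  cayley_adj R f ^+ k *m hadamard_mx n R =
  hadamard_mx n R *m diag_mx (\row_j (fourier_row R 0 j) ^+ k).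
Proof.
elim: k => [|k IHk].
  rewrite mul1mx -[LHS]mulmx1; congr (_ *m _).
  by apply/matrixP => i j; rewrite !mxE.
rewrite exprSr -mulmxA cayley_adj_mul_hadamard mulmxA IHk -mulmxA; congr (_ *m _).
apply/matrixP=> i j; rewrite mul_diag_mx !mxE exprSr.
by case: eqP => [->|_]; rewrite ?mulr0.
Qed.

(** Both sides are diagonal in the basis of characters, so it suffices to
    compare eigenvalues; J contributes only at the trivial character, whose
    A-eigenvalue is the degree wt(f). *)
Lemma cayley_adj_exp (R : realType) (k : nat) (a b : R) :
  (forall u, u != 0 -> (fourier f u)%:~R ^+ k = a * (fourier f u)%:~R) ->
  (wt f)%:R ^+ k = a * (wt f)%:R + b * 2 ^+ n ->
  cayley_adj R f ^+ k = a *: cayley_adj R f + b *: const_mx 1.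
Proof.
move=> nontrivial trivial; apply: (@hadamard_mx_inj n R) => /=.
rewrite cayley_adj_exp_mul_hadamard mulmxDl -!scalemxAl cayley_adj_mul_hadamard
  const_mx_mul_hadamard.
rewrite !scalemxAr -mulmxDr; congr (_ *m _).
apply/matrixP => i j; rewrite !mxE; case: (i =P j) => [_|_]; last first.
  by rewrite !mulr0n !mulr0 addr0.
rewrite !mulr1n; case: eqP => [->|/eqP ui_neq0].
  by rewrite fourier0.
by rewrite nontrivial // mulr0 addr0.
Qed.

End Spectrum.

(** * Walks and powers of the adjacency matrix *)

Section Walks.
Variables (T : finType) (e : rel T).

Lemma num_walks0 x y : num_walks e 0 x y = (x == y).
Proof.
rewrite /num_walks; case: eqP => [->|nxy].
  by rewrite -[RHS](@card_tuple 0 T); apply: eq_card => p;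
     rewrite inE tuple0 /= eqxx inE.
by apply: eq_card0 => p; rewrite inE tuple0 /=; apply/eqP.
Qed.

(** Sort the walks by their first step. *)
Lemma num_walksS l x y :
  num_walks e l.+1 x y = (\sum_z e x z * num_walks e l z y)%N.
Proof.
rewrite /num_walks cardsE -sum1_card.
rewrite (reindex (fun q : T * l.-tuple T => cons_tuple q.1 q.2)) /=; last first.
  exists (fun p : l.+1.-tuple T => (thead p, behead_tuple p)) => p _.
    by case: p => z q; congr (_, _); apply: val_inj.
  by rewrite [RHS]tuple_eta; apply: val_inj.
under eq_bigl => q do rewrite unfold_in /= -andbA.
rewrite -(pair_big_dep (e x)
  (fun z (p : l.-tuple T) => path e z p && (last z p == y)) (fun _ _ => 1%N)).
rewrite big_mkcond; apply: eq_bigr => z _.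
by rewrite sum1_card cardsE; case: (e x z); rewrite ?mul1n.
Qed.

Lemma adj_mx_exp (R : pzRingType) l i j :
  ((\matrix_(i, j) (e (enum_val i) (enum_val j))%:R : 'M[R]_#|T|) ^+ l) i j =
  (num_walks e l (enum_val i) (enum_val j))%:R.
Proof.
elim: l i => [|l IHl] i.
  by rewrite num_walks0 (inj_eq enum_val_inj) mxE.
rewrite exprS mxE num_walksS natr_sum.
rewrite -(sum_enum_val (fun z =>
  (e (enum_val i) z * num_walks e l z (enum_val j))%:R)).
by apply: eq_bigr => k _; rewrite IHl mxE natrM.
Qed.

End Walks.

Lemma cayley_num_walks (R : realType) n (f : 'rV['F_2]_n -> 'F_2) l x y :
  (num_walks (cayley f) l x y)%:R =
  (cayley_adj R f ^+ l) (enum_rank x) (enum_rank y).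
Proof.
rewrite -{1}(enum_rankK x) -{1}(enum_rankK y) -adj_mx_exp.
by congr (fun_of_matrix (_ ^+ _) _ _); apply/matrixP => i j; rewrite !mxE F2_natE.
Qed.

(** * Spectra of plateaued functions *)

(** Squaring removes both the absolute value and the half-integral exponent
    (n + s) / 2 from the definition of plateaued functions. *)
Lemma plateaued_fourier_sqr (R : realType) n (s : int)
    (f : 'rV['F_2]_n -> 'F_2) u :
  plateaued R s f -> u != 0 ->
  fourier f u = 0 \/ (fourier f u)%:~R ^+ 2 = 2 ^ (n%:Z + s - 2) :> R.
Proof.
move=> /(_ u) /=; rewrite walsh_hadamardE => plat /negPf u_neq0.
have u2 : (2 : R) \is a GRing.unit by rewrite unitfE pnatr_eq0.
move: plat; rewrite u_neq0 sub0r => -[/eqP|W].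
  by rewrite normr_eq0 intr_eq0 oppr_eq0 mulf_eq0 /= => /eqP; left.
right; apply: (@mulIf _ (2 ^ 2)); first by rewrite expfz_neq0 // pnatr_eq0.
rewrite -exprzDr // subrK -(powR_intmul (n%:Z + s)) // rmorphD /= -pmulrn.
(* Exposes the exponent (n + s) / 2 of the plateaued hypothesis. *)
have -> : (n%:R + s%:~R : R) = (n%:R + s%:~R) / 2 * 2%:R by field.
rewrite powRrM powR_mulrn ?powR_ge0 // -W real_normK ?num_real //.
by rewrite rmorphN rmorphM sqrrN /= exprMn mulrC.
Qed.

(** If the degree were, up to sign, the common modulus of the other nonzero
    eigenvalues, there would be at most three distinct eigenvalues. *)
Lemma four_valued_degree_neq (R : realType) n (f : 'rV['F_2]_n -> 'F_2)
    (lambda2 : R) :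
  (forall u, u != 0 -> fourier f u = 0 \/ (fourier f u)%:~R ^+ 2 = lambda2) ->
  four_valued_spectrum f -> (wt f)%:R ^+ 2 != lambda2.
Proof.
move=> spec; rewrite /four_valued_spectrum => four; apply/eqP => r2.
have : (size (undup (codom (fourier f))) <=
        size [:: 0 : int; fourier f 0; - fourier f 0])%N.
  apply: uniq_leq_size (undup_uniq _) _ => w; rewrite mem_undup => /codomP[u ->].
  case: (eqVneq u 0) => [->|/spec]; first by rewrite !inE eqxx orbT.
  rewrite !inE; case=> [->|]; first by rewrite eqxx.
  rewrite -r2 => /eqP.
  have -> : (wt f)%:R = (fourier f 0)%:~R :> R by rewrite fourier0.
  by rewrite eqf_sqr -rmorphN !eqr_int => /orP[] ->; rewrite ?orbT.
by rewrite four.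
Qed.

Theorem theorem3 (R : realType) (n : nat) (s : int)
    (f : 'rV['F_2]_n -> 'F_2) :
  (0 < n)%N ->
  plateaued R s f ->
  four_valued_spectrum f ->
  connected_graph (cayley f) ->
  let A : 'M[R]_#|{: 'rV['F_2]_n}| := cayley_adj R f in
  let r : R := (wt f)%:R in
  let mu : R := 2 ^ (- n%:Z) * r ^+ 3 - 2 ^ (s - 2) * r in
  let mu_ (t : nat) : R :=
    mu * ((2 ^ ((n%:Z + s - 2) * t%:Z) - r ^+ (2 * t))
          / (2 ^ (n%:Z + s - 2) - r ^+ 2)) in
  let sigma_ (t : nat) : R := mu_ t + 2 ^ ((n%:Z + s - 2) * t%:Z) in
  (* G_f has a loop at every vertex unless f 0 = 0 *)
  (f 0 = 0 -> forall t : nat, (1 <= t)%N ->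
     strongly_walk_regular (cayley f) (2 * t + 1)
       (sigma_ t) (mu_ t) (mu_ t)) /\
  (forall t : nat, (1 <= t)%N ->
     A ^+ (2 * t + 1) =
       2 ^ ((n%:Z + s - 2) * t%:Z) *: A + mu_ t *: const_mx 1).
Proof.
move=> _ plat four _ A r mu mu_ sigma_.
have spec u := plateaued_fourier_sqr (u := u) plat.
have r2_neq := four_valued_degree_neq spec four.
have A_exp t : (1 <= t)%N ->
    A ^+ (2 * t + 1) = 2 ^ ((n%:Z + s - 2) * t%:Z) *: A + mu_ t *: const_mx 1.
  move=> t_gt0; rewrite /mu_ -exprz_exp; set l2 := 2 ^ (n%:Z + s - 2).
  apply: cayley_adj_exp => [u /spec [->|W2]|].
  - by rewrite addn1 exprS mul0r mulr0.
  - by rewrite /l2 -W2 -exprnP -exprM addn1 exprSr.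
  (* The factor r ^+ 2 - l2 of mu cancels the denominator of mu_ t. *)
  have -> : mu = 2 ^- n * r * (r ^+ 2 - l2).
    rewrite /mu -exprnN.
    have -> : 2 ^ (s - 2) = 2 ^- n * l2.
      rewrite exprnN -exprzDr ?unitfE ?pnatr_eq0 //; congr (_ ^ _); lia.
    ring.
  rewrite -exprnP exprD expr1 -/r; field.
  by rewrite subr_eq0 eq_sym r2_neq expf_neq0 ?pnatr_eq0.
split=> // f0 t t_gt0; split; first by rewrite addn1 ltnS muln_gt0.
move=> x y; rewrite (cayley_num_walks R) A_exp // !mxE !enum_rankK mulr1 F2_natE.
rewrite -/(cayley f x y).
split=> [-> | _ /negPf-> | ->]; rewrite ?mulr1 ?mulr0 ?add0r //.
  by rewrite addrC.
by rewrite /cayley F2_vector_addrr f0 mulr0 add0r.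
Qed.
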